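(* Let $A\in\mathbb{Z}^{m\times n}$ have full row rank $m$, let $x^0\in\mathbb{Z}^n$, and put $X=\{x\in\mathbb{Z}^n\mid Ax=Ax^0\}$ and $Y=\{x\in\mathbb{R}^n\mid Ax=Ax^0\}$. Let $0\le r\le n-m$, let $R\in\mathbb{Z}^{n\times r}$ be a lattice basis of a sublattice of $L(N(A))$ of rank $r$, and let $S$ be such that $Q=(R,S)\in\mathbb{Z}^{n\times(n-m)}$ is an extension of $R$ to a lattice basis of $L(N(A))$. Let $s=n-m-r$, and let $P\in\mathbb{Z}^{(m+s)\times n}$ be such that $P^T$ is a lattice basis of $L(N(R^T))=\{y\in\mathbb{Z}^n\mid R^Ty=0\}$. Then $$X=X^{P,PS}\qquad\text{and}\qquad Y=Y^{P,PS}.$$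
   Context: For an integer matrix $A$, $N(A)=\{x \text{ real}\mid Ax=0\}$ is its null space and $L(N(A))$ is the lattice of all integer vectors in $N(A)$. A matrix is called a lattice basis of a lattice if its columns form a basis of that lattice. For $P\in\mathbb{Z}^{(m+s)\times n}$, $T\in\mathbb{Z}^{(m+s)\times s}$ and the fixed $x^0\in\mathbb{Z}^n$, $$X^{P,T}=\{x\in\mathbb{Z}^n \mid \text{there exists } \mu\in\mathbb{Z}^s \text{ with } Px=Px^0+T\mu\},$$ $$Y^{P,T}=\{x\in\mathbb{R}^n \mid \text{there exists } \mu\in\mathbb{R}^s \text{ with } Px=Px^0+T\mu\}.$$ *)

(* Defs.v *)
From HB Require Import structures.
From mathcomp Require Import all_boot all_order all_algebra.
From mathcomp Require Import boolp classical_sets reals.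

Set Implicit Arguments.
Unset Strict Implicit.
Unset Printing Implicit Defensive.

Import Order.TTheory GRing.Theory Num.Theory.

Local Open Scope classical_set_scope.
Local Open Scope ring_scope.

Definition mxR (RR : realType) (m n : nat) (A : 'M[int]_(m, n)) :
  'M[RR]_(m, n) := map_mx intr A.

Definition null_space (RR : realType) (m n : nat) (A : 'M[int]_(m, n)) :
  set 'cV[RR]_n := [set x | mxR RR A *m x = 0].
Arguments null_space RR {m n} A _.

Definition int_points (RR : realType) (n : nat) (V : set 'cV[RR]_n) :
  set 'cV[int]_n := [set z | V (mxR RR z)].

Definition sublattice (n : nat) (M L : set 'cV[int]_n) : Prop :=
  [/\ M `<=` L, M 0 & forall x y, M x -> M y -> M (x - y)].

(* The columns of B are linearly independent over the reals and generate L
   over the integers; the rank of L is then the number k of columns. *)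
Definition lattice_basis (RR : realType) (n k : nat) (B : 'M[int]_(n, k))
    (L : set 'cV[int]_n) : Prop :=
  row_free (mxR RR B)^T /\ L = [set B *m z | z in [set: 'cV[int]_k]].

Definition int_reform (p n s : nat) (P : 'M[int]_(p, n)) (T : 'M[int]_(p, s))
    (x0 : 'cV[int]_n) : set 'cV[int]_n :=
  [set x | exists mu : 'cV[int]_s, P *m x = P *m x0 + T *m mu].

Definition real_reform (RR : realType) (p n s : nat) (P : 'M[int]_(p, n))
    (T : 'M[int]_(p, s)) (x0 : 'cV[int]_n) : set 'cV[RR]_n :=
  [set x | exists mu : 'cV[RR]_s,
     mxR RR P *m x = mxR RR P *m mxR RR x0 + mxR RR T *m mu].
Arguments real_reform RR {p n s} P T x0 _.

(* Main.v *)
Require Import Defs.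
From HB Require Import structures.
From mathcomp Require Import all_boot all_order all_algebra.
From mathcomp Require Import boolp classical_sets reals.

(** The theorem says that, for [d := x - x0], the system [A d = 0] may be
    replaced by [P d = P S mu], with [mu] integer or real according to [d].
    The columns of [(R, S)] span the kernel of [A], and the columns of [R]
    span the kernel of [P].

    If [A d = 0], write [d = R z1 + S z2]; as [P R = 0], multiplying by [P]
    leaves [P d = P S z2].  For integer [d] the coefficients [z1], [z2] are
    integers because [(R, S)] is a lattice basis.
    Conversely, if [P d = P S mu], then [d - S mu] lies in the kernel of [P],
    hence is a combination of the columns of [R], and [A] kills both [R] and
    [S].  Here the combination need only have real coefficients, even for
    integer [d], since the conclusion [A d = 0] can be checked over the reals.

    Both kernels are identified over the reals by counting dimensions
    ([ker_spanned_by_rank]): [m + (r + s) = n] and [(m + s) + r = n]. *)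

Set Implicit Arguments.
Unset Strict Implicit.
Unset Printing Implicit Defensive.

Import Order.TTheory GRing.Theory Num.Theory.

Local Open Scope classical_set_scope.
Local Open Scope ring_scope.

(** The column space of [B] lies in the kernel of [A], whose dimension
    [n - \rank A] it already has. *)
Lemma ker_spanned_by_rank (F : fieldType) (p n q : nat)
    (A : 'M[F]_(p, n)) (B : 'M[F]_(n, q)) (x : 'cV[F]_n) :
  A *m B = 0 -> (\rank A + \rank B)%N = n -> A *m x = 0 ->
  exists w, x = B *m w.
Proof.
move=> AB0 rkAB Ax0.
have sBK : (B^T <= kermx A^T)%MS.
  by apply/sub_kermxP; rewrite -trmx_mul AB0 trmx0.
have sKB : (kermx A^T <= B^T)%MS.
  rewrite -(geq_leqif (mxrank_leqif_sup sBK)) mxrank_ker !mxrank_tr.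
  by rewrite leq_subLR rkAB.
have /submxP[w xw] : (x^T <= B^T)%MS.
  by apply: submx_trans sKB; apply/sub_kermxP; rewrite -trmx_mul Ax0 trmx0.
by exists w^T; rewrite -[LHS]trmxK xw trmx_mul trmxK.
Qed.

(** How [mu] is found from [z]: the coefficients of the [R]-part disappear, so
    [mu] consists of those of the [S]-part.  Over a ring, so as to serve both
    the integer and the real systems. *)
Lemma mulmx_row_mx_annihil (K : pzRingType) (p n r s : nat)
    (P : 'M[K]_(p, n)) (R : 'M[K]_(n, r)) (S : 'M[K]_(n, s))
    (z : 'cV[K]_(r + s)) :
  P *m R = 0 -> P *m (row_mx R S *m z) = P *m S *m dsubmx z.
Proof.
move=> PR0.
by rewrite -[z in LHS]vsubmxK mul_row_col mulmxDr !mulmxA PR0 mul0mx add0r.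
Qed.

(** [d - S mu] is killed by [P], so it is a combination of the columns of [R];
    [A] kills these and the columns of [S]. *)
Lemma ker_of_reform (F : fieldType) (k p n r s : nat)
    (A : 'M[F]_(k, n)) (P : 'M[F]_(p, n)) (R : 'M[F]_(n, r))
    (S : 'M[F]_(n, s)) (d : 'cV[F]_n) (mu : 'cV[F]_s) :
  A *m row_mx R S = 0 -> P *m R = 0 -> (\rank P + \rank R)%N = n ->
  P *m d = P *m S *m mu -> A *m d = 0.
Proof.
rewrite mul_mx_row -row_mx0 => /eq_row_mx[AR0 AS0] PR0 rkPR Pd.
have [|w dw] := ker_spanned_by_rank (x := d - S *m mu) PR0 rkPR.
  by rewrite mulmxBr Pd mulmxA subrr.
by rewrite -(subrK (S *m mu) d) dw mulmxDr !mulmxA AR0 AS0 !mul0mx addr0.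
Qed.

Lemma mxR_inj (RR : realType) (m n : nat) : injective (@mxR RR m n).
Proof.
move=> A B /matrixP AB; apply/matrixP => i j.
by have := AB i j; rewrite !mxE => /intr_inj.
Qed.

Lemma mxR0 (RR : realType) (m n : nat) : mxR RR (0 : 'M[int]_(m, n)) = 0.
Proof. exact: map_mx0. Qed.

Lemma mxRM (RR : realType) (m n p : nat)
    (A : 'M[int]_(m, n)) (B : 'M[int]_(n, p)) :
  mxR RR (A *m B) = mxR RR A *m mxR RR B.
Proof. exact: map_mxM. Qed.

Lemma int_points_null_spaceP (RR : realType) (m n : nat)
    (A : 'M[int]_(m, n)) (z : 'cV[int]_n) :
  int_points (null_space RR A) z <-> A *m z = 0.
Proof.
rewrite /int_points /null_space /= -mxRM -(mxR0 RR).
by split=> [/mxR_inj|->].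
Qed.

(** Each column of [B] is itself one of the integer combinations of columns of
    [B] that make up the lattice. *)
Lemma lattice_basis_annihil (RR : realType) (m n k : nat)
    (A : 'M[int]_(m, n)) (B : 'M[int]_(n, k)) :
  lattice_basis RR B (int_points (null_space RR A)) -> A *m B = 0.
Proof.
case=> _ LB; apply/matrixP => i j.
have : int_points (null_space RR A) (B *m delta_mx j 0).
  by rewrite LB; exists (delta_mx j 0).
move/int_points_null_spaceP; rewrite mulmxA -colE => /matrixP/(_ i 0).
by rewrite !mxE.
Qed.

Lemma lattice_basis_rank (RR : realType) (n k : nat) (B : 'M[int]_(n, k))
    (L : set 'cV[int]_n) : lattice_basis RR B L -> \rank (mxR RR B) = k.
Proof. by case=> /eqP; rewrite mxrank_tr. Qed.

Theorem theorem5 (RR : realType) (m n r s : nat)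
    (A : 'M[int]_(m, n)) (x0 : 'cV[int]_n)
    (R : 'M[int]_(n, r)) (S : 'M[int]_(n, s)) (P : 'M[int]_(m + s, n))
    (M : set 'cV[int]_n)
    (hA : \rank (mxR RR A) = m)
    (hr : (r <= n - m)%N)
    (hs : s = (n - m - r)%N)
    (hM : sublattice M (int_points (null_space RR A)))
    (hR : lattice_basis RR R M)
    (hQ : lattice_basis RR (row_mx R S) (int_points (null_space RR A)))
    (hP : lattice_basis RR P^T (int_points (null_space RR R^T))) :
  [set x : 'cV[int]_n | A *m x = A *m x0] = int_reform P (P *m S) x0 /\
  [set x : 'cV[RR]_n | mxR RR A *m x = mxR RR A *m mxR RR x0] =
    real_reform RR P (P *m S) x0.
Proof.
have AQ0 := lattice_basis_annihil hQ.
have PR0 : P *m R = 0.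
  by apply: trmx_inj; rewrite trmx_mul (lattice_basis_annihil hP) trmx0.
have le_mn : (m <= n)%N by rewrite -hA rank_leq_col.
have rkPR : (\rank (mxR RR P) + \rank (mxR RR R))%N = n.
  rewrite -mxrank_tr [(mxR RR P)^T]matrix.map_trmx (lattice_basis_rank hP) (lattice_basis_rank hR).
  by rewrite hs -addnA subnK // subnKC.
have rkAQ : (\rank (mxR RR A) + \rank (mxR RR (row_mx R S)))%N = n.
  by rewrite hA (lattice_basis_rank hQ) hs subnKC // subnKC.
have AQ0R : mxR RR A *m row_mx (mxR RR R) (mxR RR S) = 0.
  by rewrite -map_row_mx -mxRM AQ0 mxR0.
have PR0R : mxR RR P *m mxR RR R = 0 by rewrite -mxRM PR0 mxR0.
split; apply/seteqP; split=> x /=.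
- move=> Ax; have /(int_points_null_spaceP RR) : A *m (x - x0) = 0.
    by rewrite mulmxBr Ax subrr.
  case: hQ => _ -> [z _ dz]; exists (dsubmx z).
  by rewrite -(mulmx_row_mx_annihil S z PR0) dz -mulmxDr addrC subrK.
- case=> mu Px; apply/eqP; rewrite -subr_eq0 -mulmxBr; apply/eqP.
  (* Counting dimensions yields real coefficients on the columns of [R]. *)
  apply: (@mxR_inj RR); rewrite mxRM mxR0.
  apply: (ker_of_reform (mu := mxR RR mu) AQ0R PR0R rkPR).
  by rewrite -!mxRM mulmxBr Px addrC addKr.
- move=> Ax; have [||z dz] := @ker_spanned_by_rank _ _ _ _ (mxR RR A)
      (mxR RR (row_mx R S)) (x - mxR RR x0) _ rkAQ.
  + by rewrite -mxRM AQ0 mxR0.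
  + by rewrite mulmxBr Ax subrr.
  exists (dsubmx z).
  rewrite mxRM -(mulmx_row_mx_annihil _ z PR0R) -map_row_mx -dz.
  by rewrite -mulmxDr addrC subrK.
- case=> mu Px; apply/eqP; rewrite -subr_eq0 -mulmxBr; apply/eqP.
  apply: (ker_of_reform (mu := mu) AQ0R PR0R rkPR).
  by rewrite -mxRM mulmxBr Px addrC addKr.
Qed.
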